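(* Let $G$ and $H$ be graphs having the PH-property. Then the Cartesian product $G\square H$ has the PH-property.
   Context: Graphs are finite and simple. For a graph $G$, let $K_G$ denote the complete graph on the vertex set $V(G)$. A perfect matching of $K_G$ is called a pairing of $G$ (its edges need not belong to $G$). A graph $G$ of even order at least four has the Pairing-Hamiltonian property (PH-property; we also say $G$ is PH) if every pairing $M$ of $G$ admits a perfect matching $N\subseteq E(G)$ of $G$, disjoint from $M$, such that $M\cup N$ is (the edge set of) a Hamiltonian cycle of $K_G$. In particular, a graph with the PH-property has even order at least four by definition. The Cartesian product $G\square H$ has vertex set $V(G)\times V(H)$, where $(u,x)$ and $(v,y)$ are adjacent precisely when $u=v$ and $xy\in E(H)$, or $x=y$ and $uv\in E(G)$. *)

(* Defs.v *)
From mathcomp Require Import all_boot.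

Set Implicit Arguments.
Unset Strict Implicit.
Unset Printing Implicit Defensive.

Record sgraph := SGraph {
  vertex :> finType;
  adj : rel vertex;
  adj_sym : symmetric adj;
  adj_irrefl : irreflexive adj }.

Section Graphs.

Implicit Types G H : sgraph.

Lemma complete_sym (T : finType) : symmetric (fun x y : T => x != y).
Proof. by move=> x y; rewrite eq_sym. Qed.

Lemma complete_irrefl (T : finType) : irreflexive (fun x y : T => x != y).
Proof. by move=> x; rewrite eqxx. Qed.

Definition complete_on G : sgraph :=
  SGraph (@complete_sym (vertex G)) (@complete_irrefl (vertex G)).

Definition edges G : {set {set G}} :=
  [set [set p.1; p.2] | p : G * G & adj p.1 p.2].

(* Pairwise disjoint edges of G covering all vertices. *)
Definition perfect_matching G (M : {set {set G}}) : bool :=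
  (M \subset edges G) && partition M [set: G].

Definition pairing G (M : {set {set G}}) : bool :=
  @perfect_matching (complete_on G) M.

Definition cycle_edges G (c : seq G) : {set {set G}} :=
  [set [set x; next c x] | x in c].

(* C is the edge set of a Hamiltonian cycle of G.  The size bound
   excludes the empty sequence and [:: x; y], which ucycle accepts. *)
Definition hamiltonian_cycle G (C : {set {set G}}) : Prop :=
  exists c : seq G,
    [/\ 2 < size c, ucycle (@adj G) c, (forall x : G, x \in c)
      & C = cycle_edges c].

Definition PH G : Prop :=
  [/\ ~~ odd #|G|, 4 <= #|G|
    & forall M : {set {set G}}, pairing M ->
        exists N : {set {set G}},
          [/\ perfect_matching N, [disjoint M & N]
            & @hamiltonian_cycle (complete_on G) (M :|: N)]].

Definition cart_adj G H : rel (G * H) := fun p q =>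
  (p.1 == q.1) && adj p.2 q.2 || (p.2 == q.2) && adj p.1 q.1.

Lemma cart_adj_sym G H : symmetric (@cart_adj G H).
Proof.
move=> p q; rewrite /cart_adj [p.1 == _]eq_sym [p.2 == _]eq_sym.
by rewrite [adj p.2 _]adj_sym [adj p.1 _]adj_sym.
Qed.

Lemma cart_adj_irrefl G H : irreflexive (@cart_adj G H).
Proof. by move=> p; rewrite /cart_adj !adj_irrefl !andbF. Qed.

Definition cartesian_product G H : sgraph :=
  SGraph (@cart_adj_sym G H) (@cart_adj_irrefl G H).

End Graphs.

(* Main.v *)
Require Import Defs.
From mathcomp Require Import all_boot.

Set Implicit Arguments.
Unset Strict Implicit.
Unset Printing Implicit Defensive.

(** Matchings are handled as fixed-point-free involutions sending a vertex to
    its partner.  If [m] is a pairing and [n] a perfect matching, then the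
    union of [m] and [n] is 2-regular (with a doubled edge wherever they
    agree), so it is a Hamiltonian cycle exactly when it is connected, and the
    whole argument is about merging connected components.

    The basic move: let [W] be a set of vertices closed under [n].  Follow the
    alternating walk [m, n, m, n, ...] from a vertex of [W] until it is back in
    [W]; this first return is a pairing [p] of [W] ([first_return]).  If [n] is
    replaced on [W] by a matching [q] such that the union of [p] and [q] is
    connected, all components that meet [W] become one, and the others are
    untouched ([rematch_part]).  When [W] spans a PH graph such a [q]
    exists.  Hence, if the vertices are partitioned into parts spanning PH
    graphs and [m] connects the parts with one another, repeating the move on
    parts that meet two components ends in a single component
    ([matching_from_PH_fibres]).

    First consequence: if [G] is PH of even order, so is the prism over [G]
    ([prism_PH]).  If [m] has an edge between the two layers, the layers are
    suitable parts.  Otherwise [m] is a pair of pairings of [G]; choose [n1]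
    closing the first one to a Hamiltonian cycle and use [n1] in both layers.
    As long as two copies of a vertex [v] lie in different components, the two
    copies of the edge from [v] to [n1 v] do too, and replacing these by the
    two vertical edges on the same four vertices merges the components.  When
    this stops, every vertex is connected to its copy in the first layer, which
    has been connected from the start.

    For the product, let two vertices of [H] be in the same class when they
    are linked through second coordinates of edges of [m].  If all classes are
    even, pair [H] inside the classes and let [nH] close this pairing to a
    Hamiltonian cycle of [H].  The prisms over [G] standing on the edges of
    [nH] are PH, and [m] connects them with one another because [nH] connects
    the classes ([product_even_classes]).  If some class of [H] is odd, then
    every class of [G] is even: the product of a class of [G] and a class of
    [H] is closed under [m], hence has even size.  Exchanging the factors
    then finishes the proof ([product_PHrel]). *)

(** * Alternating walks *)

Definition pairing_map (T : finType) (m : T -> T) :=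
  involutive m /\ forall x, m x != x.

Definition joined (T : finType) (m n : T -> T) : rel T :=
  fun x y => (y == m x) || (y == n x).
Arguments joined {T} m n x y /.

(** The PH-property with connectedness in place of a Hamiltonian cycle, and
    without a bound on the order: the union of [m] and [n] may be a doubled
    edge. *)
Definition PHrel (T : finType) (e : rel T) :=
  forall m, pairing_map m -> exists n,
    [/\ pairing_map n, forall x, e x (n x) & forall x y, connect (joined m n) x y].

Section Alternating.
Variables (T : finType) (m n : T -> T).
Hypotheses (pm : pairing_map m) (pn : pairing_map n).

Lemma connect_joined_sym : connect_sym (joined m n).
Proof.
case: pm pn => mK _ [nK _]; apply: sym_connect_sym => x y /=.
by rewrite [y == m x]eq_sym [y == n x]eq_sym (inv_eq mK) (inv_eq nK).
Qed.

Lemma connect_joinedl x : connect (joined m n) x (m x).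
Proof. by apply: connect1; rewrite /= eqxx. Qed.

Lemma connect_joinedr x : connect (joined m n) x (n x).
Proof. by apply: connect1; rewrite /= eqxx orbT. Qed.

(** An alternating word of odd length is an involution: reading the walk
    backwards from its end undoes it letter by letter. *)
Lemma alternating_rewind j k x : j <= k ->
  m (iter j (n \o m) (m (iter k (n \o m) x))) = iter (k - j) (n \o m) x.
Proof.
case: pm pn => mK _ [nK _]; elim: j => [|j IHj] ltjk; first by rewrite mK subn0.
by rewrite iterS [(n \o m) _]/= (IHj (ltnW ltjk)) -(subnSK ltjk) iterS /= nK mK.
Qed.

End Alternating.

Lemma iter_comp_swap (T : Type) (m n : T -> T) k x :
  iter k (n \o m) (n x) = n (iter k (m \o n) x).
Proof. by elim: k => //= k ->. Qed.

(** An alternating word of odd length is a conjugate of its middle letter,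
    which has no fixed point; [m] and [n] exchange roles at each conjugation. *)
Lemma alternating_neq (T : finType) (m n : T -> T) k x :
  pairing_map m -> pairing_map n -> m (iter k (n \o m) x) != x.
Proof.
elim: k m n x => [|k IHk] m n x pm pn; first exact: pm.2.
rewrite iterSr /= iter_comp_swap; apply: contra (IHk n m (m x) pn pm).
by move=> /eqP e; rewrite -[n _]pm.1 e.
Qed.

(** The first return to [W] along the walk [m, n, m, ...] is a pairing of [W].
    The last property says that the walk uses [n] only outside [W], so that it
    survives any change of [n] inside [W]. *)
Lemma first_return (T : finType) (m n : T -> T) (W : pred T) :
    pairing_map m -> pairing_map n -> (forall x, W (n x) = W x) ->
  exists p : T -> T, forall x, W x ->
    [/\ W (p x), p (p x) = x, p x != x
      & forall n', (forall y, ~~ W y -> n' y = n y) ->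
          connect (joined m n') x (p x)].
Proof.
move=> pm pn nW; set s := n \o m.
have return_ex x : W x -> exists k, W (m (iter k s x)).
  move=> Wx; have s_inj : injective s
    by apply: inj_comp; apply: inv_inj; [case: pn | case: pm].
  (* the last step of the closed [s]-orbit of [x] is [n], which preserves [W] *)
  exists (order s x).-1; rewrite -nW -[n _]/(iter (order s x).-1.+1 s x).
  by rewrite orderSpred iter_order.
have /fin_all_exists[p pP] x : exists y, W x -> exists k,
    [/\ y = m (iter k s x), W y & forall j, j < k -> ~~ W (m (iter j s x))].
  case Wx: (W x); last by exists x.
  case: (ex_minnP (return_ex x Wx)) => k Wk k_min.
  exists (m (iter k s x)) => _; exists k; split=> // j ltjk.
  by apply: contraL ltjk; rewrite -leqNgt => /k_min.
exists p => x Wx; have [k [px Wpx k_min]] := pP x Wx; split=> //.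
- have [k' [ppx Wppx k'_min]] := pP _ Wpx.
  (* the walk back from [p x] has the same length, by rewinding *)
  suff eqk : k' = k by rewrite ppx eqk px alternating_rewind // subnn.
  apply/eqP; rewrite eqn_leq; apply/andP; split; rewrite leqNgt; apply/negP.
    by move=> /k'_min; rewrite px alternating_rewind // subnn Wx.
  move=> ltk'k; have := Wppx; rewrite ppx px alternating_rewind ?(ltnW ltk'k) //.
  rewrite -subnSK // iterS nW; apply/negP/k_min.
  by rewrite ltn_subrL (leq_ltn_trans _ ltk'k).
- by rewrite px alternating_neq.
move=> n' n'E; rewrite px; apply: connect_trans (connect_joinedl _ _ _).
elim: k {px} k_min => [|k IHk] k_min; first exact: connect0.
apply: connect_trans (IHk _) _ => [j ltjk|]; first by apply: k_min; rewrite ltnS ltnW.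
apply: connect_trans (connect_joinedl _ _ _) _.
by rewrite iterS -[s _]/(n (m (iter k s x))) -n'E ?k_min //; apply: connect_joinedr.
Qed.

(** * Merging components *)

(** The basic move.  The part is given as the image of an injection [f], so that
    the part can be any graph known to be PH; [p] is the first-return pairing
    transported to it.  That [p] stays within components of the old graph
    identifies [p] when the part is a union of two edges from different
    components. *)
Lemma rematch_part (T T' : finType) (f : T' -> T) (m n : T -> T) :
    pairing_map m -> pairing_map n -> injective f ->
    (forall a, n (f a) \in codom f) ->
  exists p : T' -> T',
    [/\ pairing_map p, forall a, connect (joined m n) (f a) (f (p a))
      & forall q : T' -> T', pairing_map q ->
          (forall a b, connect (joined p q) a b) ->
        exists n' : T -> T,
          [/\ pairing_map n', forall a, n' (f a) = f (q a),
              forall x, x \notin codom f -> n' x = n x,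
              subrel (connect (joined m n)) (connect (joined m n'))
            & forall a b, connect (joined m n') (f a) (f b)]].
Proof.
move=> pm pn f_inj nf; pose W := [pred x | x \in codom f].
have Wf a : W (f a) by exact: codom_f.
have nW x : W (n x) = W x.
  have Wn y : W y -> W (n y) by move=> /codomP[a ->]; apply: nf.
  by apply/idP/idP => [/Wn|/Wn //]; rewrite pn.1.
have [P PW] := first_return pm pn nW.
have /fin_all_exists[p pE] a : exists b, f b = P (f a).
  have [/codomP[b Pb] _ _ _] := PW _ (Wf a).
  by exists b.
exists p; split.
- split=> [a|a].
    by apply: f_inj; rewrite !pE; have [] := PW _ (Wf a).
  by rewrite -(inj_eq f_inj) pE; have [] := PW _ (Wf a).
- by move=> a; rewrite pE; have [_ _ _ ->] := PW _ (Wf a).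
move=> q pq pq_conn.
have /fin_all_exists[n' n'E] x : exists y,
    (forall a, x = f a -> y = f (q a)) /\ (x \notin codom f -> y = n x).
  case Wx: (x \in codom f).
    by case/codomP: Wx => b ->; exists (f (q b)); split=> // a /f_inj ->.
  by exists (n x); split=> // a xE; rewrite xE codom_f in Wx.
have n'f a : n' (f a) = f (q a) by exact: (n'E _).1.
have n'W x : x \notin codom f -> n' x = n x := (n'E x).2.
have pn' : pairing_map n'.
  split=> x; case Wx: (W x).
  - by case/codomP: Wx => a ->; rewrite !n'f pq.1.
  - have nWx : W (n x) = false by rewrite nW.
    by rewrite (n'W x (negbT Wx)) (n'W _ (negbT nWx)) pn.1.
  - by case/codomP: Wx => a ->; rewrite n'f (inj_eq f_inj) pq.2.
  - by rewrite (n'W x (negbT Wx)) pn.2.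
have connf a b : connect (joined m n') (f a) (f b).
  have /connectP[s s_path ->] := pq_conn a b.
  elim: s a s_path => [|c s IHs] a //= /andP[ac s_path].
  apply: connect_trans (IHs _ s_path); case/orP: ac => /eqP->.
    by rewrite pE; have [_ _ _ ->] := PW _ (Wf a).
  by rewrite -n'f connect_joinedr.
(* an edge of [n] inside the part is redundant: the part is now connected *)
exists n'; split=> //; apply: connect_sub => x y /= /orP[] /eqP->.
  exact: connect_joinedl.
case Wx: (x \in codom f); last by rewrite -n'W ?Wx // connect_joinedr.
by case/codomP: Wx => a ->; case/codomP: (nf a) => b ->.
Qed.

(** Each merging step strictly decreases the number of disconnected pairs, so
    a step that can be made whenever some [P]-pair is disconnected leads to a
    matching where all [P]-pairs are connected. *)
Lemma exhaustive_merging (T : finType) (m : T -> T) (I : (T -> T) -> Prop)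
    (P : rel T) n0 :
    I n0 ->
    (forall n x y, I n -> P x y -> ~~ connect (joined m n) x y ->
      exists n', [/\ I n', subrel (connect (joined m n)) (connect (joined m n'))
                   & connect (joined m n') x y]) ->
  exists n, [/\ I n, subrel (connect (joined m n0)) (connect (joined m n))
              & forall x y, P x y -> connect (joined m n) x y].
Proof.
move=> In0 step.
pose bad n := [set xy : T * T | ~~ connect (joined m n) xy.1 xy.2].
have [k] := ubnP #|bad n0|; elim: k n0 In0 => // k IHk n0 In0 badk.
case: (pickP [pred xy | P xy.1 xy.2 & ~~ connect (joined m n0) xy.1 xy.2]) => [[x y]|n0P].
  move=> /= /andP[Pxy nxy]; have [n1 [In1 sub01 n1xy]] := step _ _ _ In0 Pxy nxy.
  have [|n [In sub1 nP]] := IHk n1 In1.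
    rewrite -ltnS; apply: leq_trans badk; rewrite ltnS; apply: proper_card.
    apply/properP; split.
      by apply/subsetP => z; rewrite !inE; apply: contra => /sub01.
    by exists (x, y); rewrite inE //= negbK.
  by exists n; split=> // a b /sub01/sub1.
exists n0; split=> // x y Pxy; apply: contraFT (n0P (x, y)) => nxy.
by rewrite /= Pxy.
Qed.

(** The fibres of [pi] are the parts; each is spanned by a copy of the same PH
    graph [e'].  Every part can be made to lie in one component, and then the
    edges of [m] between the parts connect everything. *)
Lemma matching_from_PH_fibres (T T' : finType) (K : eqType) (e : rel T) (e' : rel T')
    (pi : T -> K) (m n0 : T -> T) :
    PHrel e' -> pairing_map m ->
    pairing_map n0 -> (forall x, e x (n0 x)) -> (forall x, pi (n0 x) = pi x) ->
    (forall x0, exists f : T' -> T,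
      [/\ injective f, forall x, (x \in codom f) = (pi x == pi x0)
        & forall a b, e' a b -> e (f a) (f b)]) ->
    (forall x y, connect [rel x y | (y == m x) || (pi x == pi y)] x y) ->
  exists n, [/\ pairing_map n, forall x, e x (n x)
              & forall x y, connect (joined m n) x y].
Proof.
move=> PHe' pm pn0 en0 pin0 fib conn.
pose I n := [/\ pairing_map n, forall x, e x (n x) & forall x, pi (n x) = pi x].
have [||n [[pn en _] _ nP]] :=
    @exhaustive_merging T m I [rel x y | pi x == pi y] n0; first by [].
  move=> n x y [pn en pin] /= /eqP pixy _; have [f [f_inj fE fe]] := fib x.
  have nf a : n (f a) \in codom f by rewrite fE pin -fE codom_f.
  have [p [pp _ pP]] := rematch_part pm pn f_inj nf.
  have [q [pq eq conn_pq]] := PHe' p pp.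
  have [n' [pn' n'f n'E sub_nn' connf]] := pP q pq conn_pq.
  exists n'; split=> //.
    split=> // z; case fz: (z \in codom f); do ?[by rewrite n'E ?fz].
      by case/codomP: fz => a ->; rewrite n'f fe.
    case/codomP: fz => a ->; rewrite n'f.
    have := codom_f f a; have := codom_f f (q a).
    by rewrite !fE => /eqP-> /eqP->.
  have /codomP[a ->] : x \in codom f by rewrite fE.
  have /codomP[b ->] : y \in codom f by rewrite fE pixy.
  exact: connf.
exists n; split=> // x y; apply: connect_sub (conn x y) => a b /= /orP[/eqP->|/nP //].
exact: connect_joinedl.
Qed.

(** * Parity and pairings *)

Lemma even_card_stable (T : finType) (m : T -> T) (A : {set T}) :
  pairing_map m -> (forall x, (m x \in A) = (x \in A)) -> ~~ odd #|A|.
Proof.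
(* [B] takes one vertex of each pair, the one that is enumerated first *)
move=> [mK m_neq] mA; pose B := [set x in A | enum_rank x < enum_rank (m x)].
have dA : A :\: B = m @: B.
  apply/setP => x; rewrite -[x in RHS]mK (mem_imset _ _ (inv_inj mK)) !inE mK.
  rewrite mA andbC; case: (x \in A) => //=.
  by rewrite -leqNgt leq_eqVlt (inj_eq val_inj) (inj_eq enum_rank_inj) (negPf (m_neq x)).
rewrite -(cardsID B) dA card_imset; last exact: inv_inj.
have /setIidPr -> : B \subset A by apply/subsetP => x; rewrite !inE => /andP[].
by rewrite addnn odd_double.
Qed.

(** Enumerate each fibre and pair the positions 0-1, 2-3, and so on. *)
Lemma pairing_in_fibres (T : finType) (K : eqType) (pi : T -> K) :
    (forall x, ~~ odd #|[pred y | pi y == pi x]|) ->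
  exists m, pairing_map m /\ forall x, pi (m x) = pi x.
Proof.
move=> even_pi; pose s x := enum [pred y | pi y == pi x].
pose flip i := if odd i then i.-1 else i.+1.
have flipK : involutive flip.
  by move=> [|i] //; rewrite /flip /=; case odd_i: (odd i); rewrite /= odd_i.
have flip_neq i : flip i != i.
  rewrite /flip; case: ifP; last by rewrite gtn_eqF.
  by case: i => // i _; rewrite ltn_eqF.
have mem_s x y : (y \in s x) = (pi y == pi x) by rewrite mem_enum.
have eq_s x y : pi y = pi x -> s y = s x.
  by move=> e; apply: eq_enum => z; rewrite !inE e.
have flip_lt x y : y \in s x -> flip (index y (s x)) < size (s x).
  rewrite -index_mem /flip; case: ifP => [_ | odd_i lt_i].
    exact: leq_ltn_trans (leq_pred _).
  rewrite ltn_neqAle lt_i andbT; apply: contraNneq (even_pi x).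
  by rewrite cardE -/(s x) => <- /=; rewrite odd_i.
pose m x := nth x (s x) (flip (index x (s x))).
have xs x : x \in s x by rewrite mem_s.
have pi_m x : pi (m x) = pi x.
  by apply/eqP; rewrite -mem_s mem_nth ?flip_lt.
have index_m x : index (m x) (s (m x)) = flip (index x (s x)).
  by rewrite (eq_s _ _ (pi_m x)) index_uniq ?flip_lt ?enum_uniq.
exists m; split=> //; split=> x.
  rewrite {1}/m index_m flipK (eq_s _ _ (pi_m x)).
  by rewrite (set_nth_default x) ?nth_index ?index_mem.
apply: contraNneq (flip_neq (index x (s x))) => mx.
by rewrite -index_m mx.
Qed.

Lemma pairing_even (T : finType) : ~~ odd #|T| -> exists m : T -> T, pairing_map m.
Proof.
move=> evT; have [|m [pm _]] := @pairing_in_fibres T unit (fun=> tt); last by exists m.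
by move=> x; rewrite (eq_card (B := T)).
Qed.

(** * Prisms *)

Lemma parallel_copies (G H : sgraph) (n : G -> G) :
    pairing_map n -> (forall v, adj v (n v)) ->
  pairing_map (fun x : G * H => (n x.1, x.2)) /\
  forall x : G * H, cart_adj x (n x.1, x.2).
Proof.
move=> [nK n_neq] en; split; last by move=> x; rewrite /cart_adj /= eqxx en orbT.
by split=> -[g h] /=; rewrite ?nK // xpair_eqE negb_and n_neq.
Qed.

Definition K2 : sgraph := SGraph (@complete_sym bool) (@complete_irrefl bool).

(** In the absence of [m]-edges between the layers the matchings considered
    satisfy [I]: at each vertex [n] is either the copy of [n1] in its layer or
    the vertical edge. *)
Lemma prism_PH (G : sgraph) :
  ~~ odd #|G| -> PHrel (@adj G) -> PHrel (@cart_adj G K2).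
Proof.
move=> evG PHG m pm; have [mK m_neq] := pm.
case: (pickP (fun x => (m x).2 != x.2)) => [x mx | m_hor].
  have [m1 /PHG[n1 [pn1 en1 _]]] := pairing_even evG.
  have [pn0 en0] := parallel_copies K2 pn1 en1.
  apply: (@matching_from_PH_fibres _ _ _ _ _ snd m _ PHG pm pn0 en0) => // [[v0 b0]|y z].
    exists (fun v => (v, b0)); split=> [v w [] //|[v b]|v w vw].
      by apply/codomP/eqP => [[w [_ ->]] // | /= <-]; exists v.
    by rewrite /cart_adj /= eqxx vw orbT.
  set r := [rel _ _ | _].
  have fib a b : a.2 = b.2 -> connect r a b.
    by move=> ab; apply: connect1; rewrite /= ab eqxx orbT.
  have cross a : connect r a (m a) by apply: connect1; rewrite /= eqxx.
  have [yz|yz] := eqVneq y.2 z.2; first exact: fib.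
  (* with two layers only, [x] or [m x] lies in the layer of [y] *)
  have [w wy wz] : exists2 w, y.2 = w.2 & (m w).2 = z.2.
    have [yx|yx] := eqVneq y.2 x.2.
      exists x => //; move: mx yz; rewrite yx.
      by case: (x.2) (z.2) ((m x).2) => [] [] [].
    exists (m x); last first.
      rewrite mK; move: yz yx.
      by case: (x.2) (z.2) (y.2) => [] [] [].
    by move: mx yx; case: (x.2) (y.2) ((m x).2) => [] [] [].
  apply: connect_trans (fib _ _ wy) _; apply: connect_trans (cross w) (fib _ _ wz).
have m2 x : (m x).2 = x.2 by apply/eqP/negbFE/m_hor.
pose m1 v := (m (v, true)).1.
have m1E v : (m1 v, true) = m (v, true).
  by rewrite /m1; case: (m _) (m2 (v, true)) => w b /= ->.
have pm1 : pairing_map m1.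
  split=> v; first by rewrite /m1 m1E mK.
  by have := m_neq (v, true); rewrite -m1E xpair_eqE eqxx andbT.
have [n1 [pn1 en1 conn1]] := PHG m1 pm1.
have [pn0 en0] := parallel_copies K2 pn1 en1.
pose I (n : G * K2 -> G * K2) := pairing_map n /\
  forall x, n x = (n1 x.1, x.2) \/ n x = (x.1, ~~ x.2).
have [||n [[pn nE] sub0 nP]] := @exhaustive_merging _ m I
    [rel x y | x.1 == y.1] (fun x => (n1 x.1, x.2)).
- by split=> // x; left.
- move=> n [v b] [w c] [pn nE] /= /eqP/= <-{w} vbc.
  have vNb : ~~ connect (joined m n) (v, b) (v, ~~ b).
    apply: contra vbc; case: (eqVneq c b) => [->|]; first by rewrite connect0.
    by case: b c => [] [].
  have vN d : ~~ connect (joined m n) (v, d) (v, ~~ d).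
    have [->//|] := eqVneq d b.
    rewrite (connect_joined_sym pm pn) => db.
    by move: vNb db; case: b d {vbc} => [] [] //; rewrite eqxx.
  have nv d : n (v, d) = (n1 v, d).
    have [//|nvd] := nE (v, d); case/negP: (vN d).
    by rewrite -[(v, ~~ d)]nvd connect_joinedr.
  have nn1v d : n (n1 v, d) = (v, d) by rewrite -nv pn.1.
  (* the 4-cycle over the edge [v, n1 v], to be switched from horizontal to
     vertical; [a.1] tells the end of the edge and [a.2] the layer *)
  pose f (a : bool * bool) : G * K2 := (if a.1 then v else n1 v, a.2).
  have nf a : n (f a) = f (~~ a.1, a.2) by case: a => [[] d]; rewrite /f /= ?nv ?nn1v.
  have f_inj : injective f.
    move=> [[] d] [[] d'] [] // => [->//|vn1|n1v|->//].
      by have := pn1.2 v; rewrite -vn1 eqxx.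
    by have := pn1.2 v; rewrite n1v eqxx.
  have [|p [pp conn_p pP]] := rematch_part pm pn f_inj.
    by move=> a; rewrite nf codom_f.
  (* the two edges lie in different components, so first return swaps their ends *)
  have pE a : p a = (~~ a.1, a.2).
    have nfc a' : connect (joined m n) (f a') (v, a'.2).
      by case: a' => [[] d]; rewrite /f //= -[(v, d)]nn1v connect_joinedr.
    have p2 : (p a).2 = a.2.
      apply: contraNeq (vN a.2) => pa2.
      have -> : ~~ a.2 = (p a).2 by case: (a.2) (p a).2 pa2 => [] [].
      apply: connect_trans (nfc (p a)); apply: connect_trans (conn_p a).
      by rewrite (connect_joined_sym pm pn).
    have := pp.2 a; case: a (p a) p2 => [a1 a2] [b1 b2] /= ->.
    by rewrite xpair_eqE eqxx andbT; case: a1 b1 => [] [].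
  pose q (a : bool * bool) := (a.1, ~~ a.2).
  have pq : pairing_map q by split=> [[[] []]|[[] []]].
  have conn_pq a a' : connect (joined p q) a a'.
    have cp a2 : connect (joined p q) a2 (~~ a2.1, a2.2) by rewrite -pE connect_joinedl.
    have cq a2 : connect (joined p q) a2 (a2.1, ~~ a2.2) := connect_joinedr _ _ _.
    have c1 x1 x2 y1 : connect (joined p q) (x1, x2) (y1, x2).
      case: (eqVneq y1 x1) => [->|]; first by rewrite connect0.
      by move: (cp (x1, x2)); case: x1 y1 => [] [].
    have c2 x1 x2 y2 : connect (joined p q) (x1, x2) (x1, y2).
      case: (eqVneq y2 x2) => [->|]; first by rewrite connect0.
      by move: (cq (x1, x2)); case: x2 y2 => [] [].
    case: a a' => [a1 a2] [b1 b2]; exact: connect_trans (c1 _ _ b1) (c2 _ _ _).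
  have [n' [pn' n'f n'E sub_nn' connf]] := pP q pq conn_pq.
  exists n'; split=> //; last exact: (connf (true, b) (true, c)).
  split=> // x; case fx: (x \in codom f); last by rewrite n'E ?fx.
  by case/codomP: fx => a ->; right; rewrite n'f.
exists n; split=> //.
  move=> x; case: (nE x) => ->; first exact: en0.
  by rewrite /cart_adj /= eqxx; case: (x.2).
(* the first layer was connected from the start, and merging keeps it so *)
have top v w : connect (joined m n) (v, true) (w, true).
  apply: sub0; have /connectP[s s_path ->] := conn1 v w.
  elim: s v s_path => [|u s IHs] v //= /andP[vu s_path].
  apply: connect_trans (IHs _ s_path); case/orP: vu => /eqP->.
    by rewrite m1E connect_joinedl.
  exact: (connect_joinedr m (fun x : G * K2 => (n1 x.1, x.2)) (v, true)).
move=> x y; apply: connect_trans (nP x (x.1, true) _) _; first exact: eqxx.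
by apply: connect_trans (top _ y.1) (nP _ _ _); apply: eqxx.
Qed.

(** * Cartesian products *)

(** The image of the graph of [m] under the second projection; its connected
    components are the classes whose parity decides the argument. *)
Definition class_step (T U : finType) (m : T * U -> T * U) : rel U :=
  fun h h' => [exists g, (m (g, h)).2 == h'].

Lemma class_step_m (T U : finType) (m : T * U -> T * U) x : class_step m x.2 (m x).2.
Proof. by case: x => g h; apply/existsP; exists g. Qed.

Lemma connect_class_step_sym (T U : finType) (m : T * U -> T * U) :
  involutive m -> connect_sym (class_step m).
Proof.
move=> mK; apply: sym_connect_sym.
suff link_rev h h' : class_step m h h' -> class_step m h' h.
  by move=> h h'; apply/idP/idP; apply: link_rev.
by case/existsP => g /eqP <-; have := class_step_m m (m (g, h)); rewrite mK.
Qed.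

(** The parts are the prisms over [G] standing on the edges of [nH].  Walking
    along the Hamiltonian cycle of [q] and [nH] in [H], an [nH]-step stays in
    one prism and a [q]-step stays in one class, where [m] links the prisms. *)
Lemma product_even_classes (G H : sgraph) (m : G * H -> G * H) :
    ~~ odd #|G| -> PHrel (@adj G) -> PHrel (@adj H) -> pairing_map m ->
    (forall h, ~~ odd #|connect (class_step m) h|) ->
  exists n, [/\ pairing_map n, forall x, cart_adj x (n x)
              & forall x y, connect (joined m n) x y].
Proof.
move=> evG PHG PHH pm ev_link.
have link_sym := connect_class_step_sym pm.1.
have [q [pq q_link]] : exists q,
    pairing_map q /\ forall h, connect (class_step m) h (q h).
  have [|q [pq q_root]] := @pairing_in_fibres _ _ (root (class_step m)).
    move=> h; rewrite (eq_card (B := connect (class_step m) h)) // => h'.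
    by rewrite !inE root_connect // link_sym.
  by exists q; split=> // h; rewrite link_sym -root_connect // q_root.
have [nH [pnH enH connH]] := PHH q pq.
have [m1 /PHG[n1 [pn1 en1 _]]] := pairing_even evG.
have [pn0 en0] := parallel_copies H pn1 en1.
have prismPH := prism_PH evG PHG.
pose pi (x : G * H) := [set x.2; nH x.2].
have piE x y : (pi x == pi y) = (x.2 == y.2) || (x.2 == nH y.2).
  apply/eqP/orP => [e | []/eqP e].
  - by have := set21 x.2 (nH x.2); rewrite -/(pi x) e !inE => /orP.
  - by rewrite /pi e.
  - by rewrite /pi e pnH.1 setUC.
apply: (@matching_from_PH_fibres _ _ _ _ _ pi m _ prismPH pm pn0 en0) => //.
- move=> [g0 h0]; pose f (x : G * K2) := (x.1, if x.2 then h0 else nH h0).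
  have h0_neq := pnH.2 h0; exists f; split.
  + move=> [g []] [g' []] [-> //] e; first by rewrite -e eqxx in h0_neq.
    by rewrite e eqxx in h0_neq.
  + move=> [g h]; rewrite piE /=; apply/codomP/orP => [[[g' []] [_ ->]]|].
    * by left.
    * by right.
    * by case=> /eqP->; [exists (g, true) | exists (g, false)].
  + move=> [g b] [g' b']; rewrite /cart_adj /= => /orP[]/andP[/eqP-> ab].
      rewrite eqxx; case: b b' ab => [] [] //= _; first by rewrite enH.
      by rewrite adj_sym enH.
    by rewrite eqxx ab orbT.
set r := [rel _ _ | _].
have fib x y : pi x == pi y -> connect r x y.
  by move=> xy; apply: connect1; rewrite /= xy orbT.
have fib2 g g' h : connect r (g, h) (g', h) by apply: fib; rewrite piE eqxx.
have fibN g g' h : connect r (g, h) (g', nH h).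
  by apply: fib; rewrite piE /= pnH.1 eqxx orbT.
have along_link h h' :
    connect (class_step m) h h' -> forall g g', connect r (g, h) (g', h').
  case/connectP=> s + ->; elim: s h => [|h1 s IHs] h /=.
    by move=> _ g g'; apply: fib2.
  case/andP=> /existsP[g1 /eqP h1E] s_path g g'.
  apply: connect_trans (fib2 g g1 h) _.
  apply: connect_trans (IHs _ s_path (m (g1, h)).1 _).
  by rewrite -h1E -surjective_pairing connect1 //= eqxx.
move=> [g h] [g' h']; have /connectP[s + ->] := connH h h'.
elim: s g h => [|h1 s IHs] g h /=; first by move=> _; apply: fib2.
case/andP=> hh1 s_path; apply: connect_trans (IHs g _ s_path).
by case/orP: hh1 => /eqP->; [apply: along_link | apply: fibN].
Qed.

(** A class of [G] times a class of [H] is closed under [m], so the two sizes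
    cannot both be odd. *)
Lemma product_PHrel (G H : sgraph) :
    ~~ odd #|G| -> ~~ odd #|H| -> PHrel (@adj G) -> PHrel (@adj H) ->
  PHrel (@cart_adj G H).
Proof.
move=> evG evH PHG PHH m pm; have [mK m_neq] := pm.
case: (pickP (fun h => odd #|connect (class_step m) h|)) => [h0 odd_h0|]; last first.
  by move=> ev; apply: product_even_classes => // h; rewrite ev.
pose sw (A B : Type) (x : A * B) := (x.2, x.1).
have swK (A B : Type) : cancel (@sw A B) (@sw B A) by case.
pose m' : H * G -> H * G := @sw G H \o m \o @sw H G.
have pm' : pairing_map m'.
  split=> x; first by rewrite /m' /= swK mK swK.
  by rewrite (can2_eq (@swK _ _) (@swK _ _)) m_neq.
have [|n [[nK n_neq] en conn]] := product_even_classes evH PHH PHG pm'.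
  move=> g0; pose A := setX [set g in connect (class_step m') g0]
                             [set h in connect (class_step m) h0].
  have m_link x :
      connect (class_step m') x.1 (m x).1 && connect (class_step m) x.2 (m x).2.
    rewrite !connect1 ?class_step_m //.
    by have := class_step_m m' (sw _ _ x); rewrite /m' /= swK.
  have : ~~ odd #|A|.
    apply: even_card_stable pm _ => x; rewrite !inE; have /andP[c1 c2] := m_link x.
    rewrite -(same_connect_r (connect_class_step_sym pm'.1) c1).
    by rewrite -(same_connect_r (connect_class_step_sym mK) c2).
  by rewrite cardsX !cardsE oddM odd_h0 andbT.
exists (@sw H G \o n \o @sw G H); split.
- split=> x; first by rewrite /= swK nK swK.
  by rewrite (can2_eq (@swK _ _) (@swK _ _)) n_neq.
- by move=> x; have := en (sw _ _ x); rewrite /cart_adj orbC.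
move=> x y; have /connectP[s s_path yE] := conn (sw _ _ x) (sw _ _ y).
rewrite -[y]swK yE; elim: s x s_path {yE} => [|z s IHs] x /=; first by rewrite swK.
case/andP=> xz; rewrite -[z]swK => s_path; apply: connect_trans (IHs _ s_path).
apply: connect1; case/orP: xz => /eqP->; rewrite /joined /= ?eqxx ?orbT //.
by rewrite /m' /= !swK eqxx.
Qed.

(** * From edge sets to involutions and back *)

Definition matching_of (T : finType) (m : T -> T) : {set {set T}} :=
  [set [set x; m x] | x : T].

Lemma matching_of_eq (T : finType) (m : T -> T) x y :
  [set x; y] \in matching_of m -> involutive m -> (forall z, m z != z) -> y = m x.
Proof.
case/imsetP=> z _ e mK m_neq.
have := set21 x y; have := set22 x y; rewrite e !inE => /orP[]/eqP y_e /orP[]/eqP x_e.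
- by move: (set22 z (m z)); rewrite -e y_e x_e setUid inE (negPf (m_neq z)).
- by rewrite y_e x_e mK.
- by rewrite y_e x_e.
- by move: (set21 z (m z)); rewrite -e y_e x_e setUid inE eq_sym (negPf (m_neq z)).
Qed.

Lemma perfect_matching_of (G : sgraph) (m : G -> G) :
    involutive m -> (forall x, adj x (m x)) ->
  perfect_matching (matching_of m).
Proof.
move=> mK em; apply/andP; split.
  apply/subsetP => _ /imsetP[x _ ->]; apply/imsetP.
  by exists (x, m x) => //; rewrite inE em.
apply/and3P; split.
- apply/eqP/setP => x; rewrite inE; apply/bigcupP; exists [set x; m x]; last exact: set21.
  exact: imset_f.
- apply/trivIsetP => _ _ /imsetP[x _ ->] /imsetP[y _ ->]; apply: contraR.
  case/pred0Pn => z /=; rewrite !inE => /andP[zx zy].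
  have pair_z w : (z == w) || (z == m w) -> [set w; m w] = [set z; m z].
    by case/orP=> /eqP->; rewrite // mK setUC.
  by rewrite (pair_z x) // (pair_z y).
- apply/imsetP => -[x _ /setP/(_ x)]; by rewrite !inE eqxx.
Qed.

Lemma perfect_matching_map (G : sgraph) (M : {set {set G}}) :
  perfect_matching M ->
  exists m, [/\ pairing_map m, forall x, adj x (m x) & M = matching_of m].
Proof.
case/andP=> /subsetP M_edges /and3P[/eqP M_cover M_triv _].
have M_eq A B x : A \in M -> B \in M -> x \in A -> x \in B -> A = B.
  by move=> AM BM xA xB; rewrite -(def_pblock M_triv AM xA) (def_pblock M_triv BM xB).
have /fin_all_exists[m mP] x : exists y, adj x y /\ [set x; y] \in M.
  have /bigcupP[A AM xA] : x \in cover M by rewrite M_cover.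
  have /imsetP[[a b] ab A_e] := M_edges A AM; rewrite {}A_e /= in AM xA.
  rewrite inE /= in ab; case/set2P: xA => ->; first by exists b.
  by exists a; rewrite adj_sym ab setUC.
have em x : adj x (m x) := (mP x).1.
have m_neq x : m x != x by apply: contraTneq (em x) => ->; rewrite adj_irrefl.
have mK : involutive m.
  move=> x; have e : [set x; m x] = [set m x; m (m x)].
    by apply: (M_eq _ _ (m x)); rewrite ?(mP _).2 ?set21 ?set22.
  by move: (set22 (m x) (m (m x))); rewrite -e !inE (negPf (m_neq (m x))) orbF => /eqP.
exists m; split=> //; apply/setP => A.
apply/idP/imsetP => [AM|[x _ ->]]; last exact: (mP x).2.
have /imsetP[[a b] _ A_e] := M_edges A AM.
by exists a => //; apply: (M_eq _ _ a) => //; rewrite ?(mP a).2 // ?A_e ?set21.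
Qed.

Lemma cycle_connect (T : finType) (e : rel T) (c : seq T) :
  (forall x, x \in c -> connect e x (next c x)) -> uniq c ->
  forall x y, x \in c -> y \in c -> connect e x y.
Proof.
move=> ec c_uniq x y xc yc.
have c_cycle : fcycle (next c) c by apply: cycle_next.
have /connectP[s s_path ->] : fconnect (next c) x y.
  by rewrite (fconnect_cycle c_cycle xc).
elim: s x xc s_path => [|z s IHs] x xc //= /andP[/eqP<- s_path].
by apply: connect_trans (ec x xc) (IHs _ _ s_path); rewrite mem_next.
Qed.

Lemma PH_PHrel (G : sgraph) : PH G -> PHrel (@adj G).
Proof.
move=> [_ _ PHG] m [mK m_neq].
have [|N [/perfect_matching_map[n [pn en ->]] _ [c [_ /andP[_ c_uniq] c_all c_e]]]] :=
  PHG (matching_of m).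
  by apply: (@perfect_matching_of (complete_on G) m mK) => x; rewrite /= eq_sym.
exists n; split=> // x y; apply: cycle_connect (c_all x) (c_all y) => // z zc.
have : [set z; next c z] \in cycle_edges c by apply: imset_f.
rewrite -c_e inE => /orP[] /matching_of_eq -> //.
- exact: connect_joinedl.
- exact: connect_joinedr.
- exact: pn.1.
- exact: pn.2.
Qed.

(** To turn the connected union of [m] and [n] into a cyclic sequence one needs
    an orientation.  Let [A] be the orbit of [x0] under [n \o m]; then [m]
    exchanges [A] with its complement, and so does [n].  Leaving [A] by [m] and
    entering it by [n] is an injective successor map whose only orbit is the
    Hamiltonian cycle. *)
Lemma PHrel_PH (G : sgraph) : ~~ odd #|G| -> 4 <= #|G| -> PHrel (@adj G) -> PH G.
Proof.
move=> evG G4 PHG; split=> // _ /perfect_matching_map[m [pm _ ->]].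
have [n [pn en conn]] := PHG m pm; have [mK m_neq] := pm; have [nK n_neq] := pn.
exists (matching_of n).
have closed_all (A : {set G}) x0 :
    x0 \in A -> (forall x, x \in A -> m x \in A /\ n x \in A) -> forall x, x \in A.
  move=> Ax0 A_stable x; have /connectP[s s_path ->] := conn x0 x.
  elim: s x0 Ax0 s_path => [|z s IHs] x0 //= /A_stable[mA nA] /andP[zx0].
  by apply: IHs; case/orP: zx0 => /eqP->.
have [x0 _] : exists x0, x0 \in G by apply/card_gt0P; apply: leq_trans G4.
have nm_inj : injective (n \o m) by apply: inj_comp; apply: inv_inj.
pose A := [set x | fconnect (n \o m) x0 x].
have A0 : x0 \in A by rewrite inE connect0.
have A_nm x : x \in A -> n (m x) \in A.
  by rewrite !inE => /connect_trans; apply; apply: (fconnect1 (n \o m)).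
(* otherwise an alternating word of odd length would have a fixed point *)
have Am x : x \in A -> m x \notin A.
  rewrite !inE => x0x; apply/negP => x0mx.
  have /iter_findex e : fconnect (n \o m) x (m x).
    by apply: connect_trans x0mx; rewrite fconnect_sym.
  have := alternating_neq (findex (n \o m) x (m x)) x pm pn.
  by rewrite e mK eqxx.
have A_mn x : x \in A -> m (n x) \in A.
  rewrite !inE => x0x; apply: connect_trans x0x _; rewrite fconnect_sym //.
  by have := fconnect1 (n \o m) (m (n x)); rewrite /= mK nK.
have notA x : x \notin A -> m x \in A.
  have : x \in A :|: m @: A.
    apply: (closed_all (A :|: m @: A) x0); first by rewrite inE A0.
    move=> y /setUP[yA|/imsetP[z zA ->]]; rewrite !in_setU.
      split; first by rewrite (imset_f m yA) orbT.
      by rewrite -[n y]mK (imset_f m (A_mn y yA)) orbT.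
    by rewrite mK zA A_nm.
  by case/setUP => [->//|/imsetP[z zA ->] _]; rewrite mK.
pose sigma x := if x \in A then m x else n x.
have sigma_A x : (sigma x \in A) = (x \notin A).
  rewrite /sigma; case: ifP => [xA|/negbT xA]; first by rewrite (negPf (Am x xA)).
  by rewrite -[x]mK A_nm // notA.
have sigma_inj : injective sigma.
  move=> x y e; have := sigma_A x; rewrite e sigma_A => /negb_inj AA.
  by move: e; rewrite /sigma AA; case: ifP => _; apply: inv_inj.
have sigma_all x : fconnect sigma x0 x.
  have walk s y : y \in A -> fconnect sigma x0 y -> fpath (n \o m) y s ->
      fconnect sigma x0 (last y s).
    elim: s y => [|z s IHs] y //= yA x0y /andP[/eqP <- s_path].
    apply: IHs s_path; first exact: A_nm.
    apply: connect_trans x0y _; apply: connect_trans (fconnect1 sigma _) _.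
    have -> : n (m y) = sigma (sigma y).
      by rewrite {1}/sigma sigma_A yA /= /sigma yA.
    exact: fconnect1.
  have sA y : y \in A -> fconnect sigma x0 y.
    by rewrite inE => /connectP[s s_path ->]; apply: walk s_path; rewrite ?connect0.
  case xA: (x \in A); first exact: sA.
  apply: connect_trans (sA _ (notA _ (negbT xA))) _.
  by have := fconnect1 sigma (m x); rewrite {2}/sigma notA ?xA // mK.
pose c := orbit sigma x0.
have c_cycle : fcycle sigma c by apply: cycle_orbit.
have c_all x : x \in c by rewrite -fconnect_orbit.
have c_next x : next c x = sigma x by apply/esym/eqP; apply: (next_cycle c_cycle).
have sigma_neq x : x != sigma x by rewrite /sigma eq_sym; case: ifP.
split.
- exact: perfect_matching_of.
- apply/pred0P => B /=; apply/negP => /andP[/imsetP[x _ ->]].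
  (* a common edge would be a whole component with two vertices *)
  move/matching_of_eq => /(_ nK n_neq) mx_nx.
  have two y : y \in [set x; m x].
    apply: (closed_all _ x (set21 _ _)) => z /set2P[] ->.
      by rewrite -mx_nx set22.
    by rewrite mK {2}mx_nx nK set21.
  suff : #|G| <= 2 by rewrite leqNgt (leq_trans _ G4).
  rewrite -cardsT; apply: leq_trans (_ : #|[set x; m x]| <= 2).
    by apply: subset_leq_card; apply/subsetP => y _.
  by rewrite cards2; case: eqP.
exists c; split=> //.
- rewrite (_ : size c = #|G|) ?(leq_trans _ G4) //.
  by rewrite -(card_uniqP (orbit_uniq _ _)); apply: eq_card => x; rewrite c_all.
- apply/andP; split; last exact: orbit_uniq.
  by apply: sub_cycle c_cycle => x y /eqP <-; apply: sigma_neq.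
apply/setP => B; rewrite inE; apply/orP/imsetP => [[]/imsetP[x _ ->]|[x _ ->]].
- case xA: (x \in A); first by exists x; rewrite ?c_all // c_next /sigma xA.
  exists (m x); rewrite ?c_all // c_next /sigma notA ?xA //.
  by rewrite mK setUC.
- case xA: (x \in A); last by exists x; rewrite ?c_all // c_next /sigma xA.
  have nxA : (n x \in A) = false.
    by apply: contraNF (Am x xA) => /A_mn; rewrite nK.
  exists (n x); rewrite ?c_all // c_next /sigma nxA nK setUC //.
rewrite c_next /sigma; case: ifP => _; [left | right]; exact: imset_f.
Qed.

Theorem theorem3p1 (G H : sgraph) :
  PH G -> PH H -> PH (cartesian_product G H).
Proof.
move=> PHG PHH; have [evG G4 _] := PHG; have [evH H4 _] := PHH.
apply: PHrel_PH; rewrite /= ?card_prod ?oddM ?(negPf evG) //.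
  by rewrite (leq_trans G4) // leq_pmulr // (leq_trans _ H4).
by apply: product_PHrel => //; apply: PH_PHrel.
Qed.
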